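(* For a positive integer $m$, let $\mathcal{L}_m$ denote the number of vertices of a longest (simple) path in a Random Apollonian Network with $m$ bounded faces. Then asymptotically almost surely $\mathcal{L}_m = o(m)$; that is, for every fixed $\varepsilon>0$, $\lim_{m\to\infty}\mathbb{P}(\mathcal{L}_m \le \varepsilon m) = 1$.
   Context: A Random Apollonian Network (RAN) is built as follows: start with a triangle embedded in the plane; in each step choose a bounded face uniformly at random (independently of previous choices), add a new vertex inside it and join the new vertex to the three vertices of that face. After $n-3$ steps one obtains a random triangulated plane graph with $n$ vertices and $m=2n-5$ bounded faces; ''faces'' always means bounded faces. A path means a simple path. *)

(* Defs.v *)
From HB Require Import structures.
From mathcomp Require Import all_boot all_order all_algebra.
From mathcomp Require Import all_classical all_reals all_analysis.
Import Order.TTheory GRing.Theory Num.Theory.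
Import numFieldNormedType.Exports.

Set Implicit Arguments.
Unset Strict Implicit.
Unset Printing Implicit Defensive.

(* Number of vertices of a longest simple path of the graph [e]; a simple path
   has at most [#|T|] vertices, so the maximum is over all simple paths. *)
Definition longest_path (T : finType) (e : rel T) : nat :=
  \max_(l < #|T|.+1 | [exists p : l.-tuple T, uniq p && sorted e p]) l.

(* Sample space of the first [k] steps: step number [j] (counting from 0)
   chooses one of the [2j + 1] bounded faces present at that time, so
   [ran_history k] is the product of ['I_(2j + 1)] over [j < k]. *)
Fixpoint ran_history (k : nat) : finType :=
  if k is k'.+1 then (ran_history k' * 'I_(k'.*2.+1))%type else unit.

(* The vertices after [k] steps are [0, ..., k + 2]: the initial triangle is
   [0, 1, 2] and the vertex added by step [j] is [j + 3].  The plane embedding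
   is recorded by the list of the vertex triples of the bounded faces: putting
   a vertex inside the face [(a, b, c)] and joining it to [a], [b] and [c]
   replaces this face by three faces and leaves all the others unchanged. *)
Definition face : Type := (nat * nat * nat)%type.

Definition face_vertices (f : face) : seq nat := [:: f.1.1; f.1.2; f.2].

Definition split_face (v : nat) (f : face) : seq face :=
  let: (a, b, c) := f in [:: (v, b, c); (a, v, c); (a, b, v)].

(* The default value of [nth] is never used, by [size_ran_faces] below. *)
Definition nth_face (fs : seq face) (i : nat) : face := nth (0, 0, 0) fs i.

Fixpoint ran_faces (k : nat) : ran_history k -> seq face :=
  if k is k'.+1 return ran_history k -> seq face then fun h =>
    let fs := ran_faces h.1 in
    take h.2 fs ++ split_face k'.+3 (nth_face fs h.2) ++ drop h.2.+1 fs
  else fun=> [:: (0, 1, 2)].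

Lemma size_ran_faces (k : nat) (h : ran_history k) :
  size (ran_faces h) = k.*2.+1.
Proof.
elim: k h => [|k IHk] //= [h i] /=.
rewrite !size_cat size_take size_drop IHk ltn_ord subSS.
case: (nth_face _ _) => [[a b] c] /=.
by rewrite !addnS subnKC // -ltnS.
Qed.

Fixpoint ran_adj (k : nat) : ran_history k -> rel nat :=
  if k is k'.+1 return ran_history k -> rel nat then fun h =>
    let f := face_vertices (nth_face (ran_faces h.1) h.2) in
    fun u v => [|| ran_adj h.1 u v,
                   (u == k'.+3) && (v \in f) | (v == k'.+3) && (u \in f)]
  else fun=> fun u v => [&& u != v, u < 3 & v < 3].

Definition ran_graph (k : nat) (h : ran_history k) : rel 'I_(k.+3) :=
  fun u v => ran_adj h u v.

(* The choices being uniform and independent, the law of the history is the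
   uniform probability on the product [ran_history k]. *)
Definition ran_prob (R : realType) (k : nat) (A : {set ran_history k}) : R :=
  (#|A|%:R / #|ran_history k|%:R)%R.

(* Main.v *)
Require Import Defs.
From HB Require Import structures.
From mathcomp Require Import all_boot all_order all_algebra.
From mathcomp Require Import all_classical all_reals all_analysis.
From mathcomp Require Import zify ring lra.
Import Order.TTheory GRing.Theory Num.Theory.
Import numFieldNormedType.Exports.

(* After two complete subdivisions a face is cut into nine faces by the three
   corners and the four new vertices.  Removing these seven vertices breaks a
   path into at most eight pieces, so the path misses the interior of one of the
   nine faces.  Pruning the worst grandchild recursively gives a functional
   [surv] of the ternary tree of subdivisions, with [longest path <= surv + 3].
   Given the first subdivision, the three subtrees are independent and their
   sizes follow a Polya urn, whose law at time [k] is bounded below by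
   [1 / (4k^2 - 1)] at every point.  If [E surv <= rho k + O(1)], then with
   positive probability each of the nine grandchildren has linear size and keeps
   a positive proportion of its nodes, so that pruning improves [rho] by an
   amount depending only on [rho].  Hence [E surv = o(k)], and Markov's
   inequality concludes. *)

Set Implicit Arguments.
Unset Strict Implicit.
Unset Printing Implicit Defensive.

(** * Combinatorics of paths *)

Inductive tree := Leaf | Node of tree & tree & tree.

Fixpoint leaves (t : tree) : nat :=
  if t is Node a b c then leaves a + leaves b + leaves c else 1.

Fixpoint grow (t : tree) (i : nat) : tree :=
  if t is Node a b c then
    if i < leaves a then Node (grow a i) b c
    else if i < leaves a + leaves b then Node a (grow b (i - leaves a)) c
    else Node a b (grow c (i - (leaves a + leaves b)))
  else Node Leaf Leaf Leaf.

Fixpoint tree_size (t : tree) : nat :=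
  if t is Node a b c then (tree_size a + tree_size b + tree_size c).+1 else 0.

Lemma leavesE t : leaves t = (tree_size t).*2.+1.
Proof. by elim: t => //= a -> b -> c ->; lia. Qed.

Lemma tree_size_grow t i : tree_size (grow t i) = (tree_size t).+1.
Proof.
elim: t i => //= a IHa b IHb c IHc i.
by do 2?case: ifP => _ /=; rewrite ?IHa ?IHb ?IHc; lia.
Qed.

(* [(prune t).1.1] bounds the number of inner nodes that a path can visit, by
   discarding at each even level the least favourable of the nine
   grandchildren.  The other two components (the sum, with one for the root,
   and the minimum of this bound over the children) reduce this recursion over
   grandchildren to one over children. *)
Fixpoint prune (t : tree) : nat * nat * nat :=
  if t is Node a b c then
    ((((prune a).1.2 + (prune b).1.2 + (prune c).1.2).+1 -
       minn (prune a).2 (minn (prune b).2 (prune c).2),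
      ((prune a).1.1 + (prune b).1.1 + (prune c).1.1).+1),
      minn (prune a).1.1 (minn (prune b).1.1 (prune c).1.1))
  else (0, 0, 0).

Definition surv (t : tree) : nat := (prune t).1.1.
Definition surv1 (t : tree) : nat := (prune t).1.2.
Definition minsurv (t : tree) : nat := (prune t).2.

Lemma survN a b c : surv (Node a b c) =
  (surv1 a + surv1 b + surv1 c).+1 - minn (minsurv a) (minn (minsurv b) (minsurv c)).
Proof. by []. Qed.

Lemma surv1N a b c : surv1 (Node a b c) = (surv a + surv b + surv c).+1.
Proof. by []. Qed.

Lemma minsurvN a b c : minsurv (Node a b c) = minn (surv a) (minn (surv b) (surv c)).
Proof. by []. Qed.

(** Because of this the subtraction in [survN] never truncates. *)
Lemma minsurv_le t : minsurv t <= surv1 t.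
Proof. case: t => // a b c; rewrite minsurvN surv1N; lia. Qed.

Lemma surv_le_size t : (surv t <= tree_size t) && (surv1 t <= tree_size t).
Proof.
elim: t => // a /andP[? ?] b /andP[? ?] c /andP[? ?].
rewrite survN surv1N /=; lia.
Qed.

(* The last inequality keeps the difference [surv1 - minsurv] monotone, which is
   what the truncated subtraction in [survN] needs. *)
Lemma surv_grow t i : [/\ surv t <= surv (grow t i), minsurv t <= minsurv (grow t i)
  & surv1 t + minsurv (grow t i) <= surv1 (grow t i) + minsurv t].
Proof.
elim: t i => [//|a IHa b IHb c IHc] i /=.
have [? ? ?] := And3 (minsurv_le a) (minsurv_le b) (minsurv_le c).
have [? ? ?] := IHa i.
have [? ? ?] := IHb (i - leaves a).
have [? ? ?] := IHc (i - (leaves a + leaves b)).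
by do 2?case: ifP => _; rewrite !survN !surv1N !minsurvN; split; lia.
Qed.

(* A node carries the vertex inserted in its face; the leaves, from left to
   right, are the bounded faces in the order of [ran_faces]. *)
Inductive ltree := LLeaf | LNode of nat & ltree & ltree & ltree.

Fixpoint unlabel (t : ltree) : tree :=
  if t is LNode _ a b c then Node (unlabel a) (unlabel b) (unlabel c) else Leaf.

Fixpoint lgrow (n : nat) (t : ltree) (i : nat) : ltree :=
  if t is LNode v a b c then
    let la := leaves (unlabel a) in let lb := leaves (unlabel b) in
    if i < la then LNode v (lgrow n a i) b c
    else if i < la + lb then LNode v a (lgrow n b (i - la)) c
    else LNode v a b (lgrow n c (i - (la + lb)))
  else LNode n LLeaf LLeaf LLeaf.

Lemma unlabel_lgrow n t i : unlabel (lgrow n t i) = grow (unlabel t) i.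
Proof.
elim: t i => //= v a IHa b IHb c IHc i.
by do 2?case: ifP => _ /=; rewrite ?IHa ?IHb ?IHc.
Qed.

Fixpoint verts (t : ltree) : seq nat :=
  if t is LNode v a b c then v :: verts a ++ verts b ++ verts c else [::].

Lemma verts_lgrow n t i : perm_eq (verts (lgrow n t i)) (n :: verts t).
Proof.
apply/permP => P; elim: t i => //= v a IHa b IHb c IHc i.
by do 2?case: ifP => _ /=; rewrite !count_cat ?IHa ?IHb ?IHc /=; lia.
Qed.

Fixpoint leaf_faces (t : ltree) (f : face) : seq face :=
  if t is LNode v a b c then
    let: (x, y, z) := f in
    leaf_faces a (v, y, z) ++ leaf_faces b (x, v, z) ++ leaf_faces c (x, y, v)
  else [:: f].

Lemma size_leaf_faces t f : size (leaf_faces t f) = leaves (unlabel t).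
Proof.
elim: t f => //= v a IHa b IHb c IHc [[x y] z].
by rewrite !size_cat IHa IHb IHc addnA.
Qed.

(** The right-hand side is the recursion of [ran_faces], so the list of faces can be read off the
    labelled tree. *)
Lemma leaf_faces_lgrow n t i f : i < leaves (unlabel t) ->
  leaf_faces (lgrow n t i) f =
  take i (leaf_faces t f) ++ split_face n (nth_face (leaf_faces t f) i)
    ++ drop i.+1 (leaf_faces t f).
Proof.
rewrite /nth_face.
elim: t i f => [|v a IHa b IHb c IHc] /= i [[x y] z]; first by case: i.
move=> lti; case: ifP => [ia|/negbT ia]; last case: ifP => [ib|/negbT ib].
- rewrite /= IHa // take_cat nth_cat drop_cat size_leaf_faces ia.
  rewrite -!catA; do 2 congr (_ ++ _).
  (* If [i] is the last leaf of [a], the suffix to keep starts exactly at the leaves of [b]. *)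
  case: ifP => [//|/negbT iSa].
  rewrite (_ : i.+1 = leaves (unlabel a)); last lia.
  by rewrite subnn drop0 drop_oversize // size_leaf_faces.
- rewrite /= IHb; last lia.
  rewrite take_cat nth_cat drop_cat size_leaf_faces (negbTE ia).
  have -> : (i.+1 < leaves (unlabel a)) = false by lia.
  rewrite take_cat nth_cat drop_cat !size_leaf_faces.
  have -> : i - leaves (unlabel a) < leaves (unlabel b) by lia.
  rewrite subSn; last lia.
  rewrite -!catA; do 3 congr (_ ++ _).
  case: ifP => [//|/negbT iSb].
  rewrite (_ : (i - leaves (unlabel a)).+1 = leaves (unlabel b)); last lia.
  by rewrite subnn drop0 drop_oversize // size_leaf_faces.
- rewrite /= IHc; last lia.
  rewrite take_cat nth_cat drop_cat size_leaf_faces (negbTE ia).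
  have -> : (i.+1 < leaves (unlabel a)) = false by lia.
  rewrite take_cat nth_cat drop_cat !size_leaf_faces.
  have -> : i - leaves (unlabel a) < leaves (unlabel b) = false by lia.
  have -> : i.+1 - leaves (unlabel a) < leaves (unlabel b) = false by lia.
  have -> : i.+1 - leaves (unlabel a) - leaves (unlabel b) =
     (i - (leaves (unlabel a) + leaves (unlabel b))).+1 by lia.
  by rewrite subnDA -!catA.
Qed.

Lemma leaf_faces_verts t f g u : g \in leaf_faces t f ->
  u \in face_vertices g -> u \in verts t ++ face_vertices f.
Proof.
elim: t f => [|v a IHa b IHb c IHc] [[x y] z] /=; first by rewrite inE => /eqP ->.
rewrite !mem_cat => /or3P[/IHa|/IHb|/IHc] H /H;
  rewrite !(mem_cat, inE) /=; do ?[case/orP]; move=> ->; by rewrite ?orbT.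
Qed.

(* For every face, at any stage of the subdivision, its three vertices separate
   the vertices inserted inside it from the rest of the graph. *)
Fixpoint sep (adj : rel nat) (t : ltree) (f : face) : Prop :=
  if t is LNode v a b c then
    let: (x, y, z) := f in
    [/\ forall u w, u \in verts t -> adj u w -> w \in verts t ++ [:: x; y; z],
        sep adj a (v, y, z), sep adj b (x, v, z) & sep adj c (x, y, v)]
  else True.

Lemma sep_closed adj t f u w : sep adj t f ->
  u \in verts t -> adj u w -> w \in verts t ++ face_vertices f.
Proof. by case: t f => // v a b c [[x y] z] [+ _ _ _]; apply. Qed.


(** Comparing multiplicities reduces uniqueness of rearranged sublists to linear arithmetic. *)
Lemma uniq_leq_count (T : eqType) (s s' : seq T) :
  (forall u, count_mem u s <= count_mem u s') -> uniq s' -> uniq s.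
Proof.
move=> le uq; apply: count_mem_uniq => u.
rewrite -has_pred1 has_count; have := le u; rewrite (count_uniq_mem u uq).
by case: count (u \in s') => [|[|k]] [].
Qed.

(** This has the shape of the successor case of [ran_adj], where [F] lists the corners of the split
    face. *)
Definition add_vertex (adj : rel nat) (n : nat) (F : seq nat) : rel nat :=
  fun u v => [|| adj u v, (u == n) && (v \in F) | (v == n) && (u \in F)].

(** * Separation is preserved by the insertion of a vertex *)

Section AddVertex.
Variables (adj : rel nat) (n : nat).
Hypothesis adjn : forall u, ~~ adj n u.

(** Both ends of a new edge lie in [n :: F], so a face with none of these vertices in its interior
    sees no new edge. *)
Lemma sep_away F t f : (forall u, u \in n :: F -> u \notin verts t) ->
  sep adj t f -> sep (add_vertex adj n F) t f.
Proof.
elim: t f => //= v a IHa b IHb c IHc [[x y] z] away [cl sa sb sc].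
split; first last.
- by apply: IHc => // u /away; rewrite !(inE, mem_cat) !negb_or => /andP[_ /and3P[]].
- by apply: IHb => // u /away; rewrite !(inE, mem_cat) !negb_or => /andP[_ /and3P[]].
- by apply: IHa => // u /away; rewrite !(inE, mem_cat) !negb_or => /andP[_ /and3P[]].
move=> u w uV /or3P[|/andP[/eqP un _]|/andP[_ uF]]; first exact: cl.
- by have := away u; rewrite uV un mem_head => /(_ isT).
- by have := away u; rewrite uV inE uF orbT => /(_ isT).
Qed.

(** A new edge joins [n], now interior, to a vertex of [F], interior or a corner; an old edge cannot
    start at [n]. *)
Lemma lgrow_closed t f i F u w : sep adj t f ->
  {subset F <= verts t ++ face_vertices f} ->
  u \in verts (lgrow n t i) -> add_vertex adj n F u w ->
  w \in verts (lgrow n t i) ++ face_vertices f.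
Proof.
move=> st FV; rewrite mem_cat !(perm_mem (verts_lgrow _ _ _)) ![_ \in n :: _]in_cons -orbA -mem_cat.
move=> un /or3P[|/andP[_ /FV ->]|/andP[/eqP-> _]]; rewrite ?eqxx ?orbT //.
case: (eqVneq u n) un => [->|_] un; first by rewrite (negbTE (adjn w)).
by move=> /(sep_closed st un) ->; rewrite orbT.
Qed.

(** Only the child containing the split leaf changes, which is the induction; [sep_away] handles its
    two siblings. *)
Lemma sep_lgrow t i f : i < leaves (unlabel t) ->
  uniq (verts t ++ face_vertices f) -> n \notin verts t ++ face_vertices f ->
  sep adj t f ->
  sep (add_vertex adj n (face_vertices (nth_face (leaf_faces t f) i)))
    (lgrow n t i) f.
Proof.
move En : (nth_face _ _) => F.
have FV t' f' i' : i' < leaves (unlabel t') -> nth_face (leaf_faces t' f') i' = F ->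
    {subset face_vertices F <= verts t' ++ face_vertices f'}.
  move=> lt' <- u; apply: leaf_faces_verts.
  by rewrite mem_nth // size_leaf_faces.
elim: t i f En => [|v a IHa b IHb c IHc] i f En lti uq nt st.
  have clos u w := @lgrow_closed _ _ i _ u w st (FV _ _ _ lti En).
  by move: f clos {En uq nt st} => [[x y] z]; split.
have clos u w := @lgrow_closed _ _ i _ u w st (FV _ _ _ lti En).
move: f En uq nt st clos => [[x y] z] En uq nt st clos; have uq0 := uq.
move: En lti uq nt st clos => /=.
move=> + + _.
rewrite /nth_face !nth_cat !size_leaf_faces -/(nth_face _ _) -/(nth_face _ _) -/(nth_face _ _).
set la := leaves (unlabel a); set lb := leaves (unlabel b); set lc := leaves (unlabel c).
move=> En lti; rewrite !(inE, mem_cat) !negb_or => /andP[nv /andP[/and3P[na nb nc] /and3P[nx ny nz]]] [cl sa sb sc] clos.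
have uqa : uniq (verts a ++ [:: v; y; z]).
  by apply: uniq_leq_count uq0 => u; rewrite /= !count_cat /=; lia.
have uqb : uniq (verts b ++ [:: x; v; z]).
  by apply: uniq_leq_count uq0 => u; rewrite /= !count_cat /=; lia.
have uqc : uniq (verts c ++ [:: x; y; v]).
  by apply: uniq_leq_count uq0 => u; rewrite /= !count_cat /=; lia.
have disj s1 s2 u : uniq (s1 ++ s2) -> u \in s1 -> u \notin s2.
  by rewrite cat_uniq => /and3P[_ /hasPn dis _] u1; apply/negP => /dis; rewrite u1.
(* The corners of the split face lie inside or on the child [t1], hence never in the interior of a
   sibling [t2]. *)
have away t1 t2 f1 i1 : i1 < leaves (unlabel t1) -> nth_face (leaf_faces t1 f1) i1 = F ->
    n \notin verts t2 -> uniq ((verts t1 ++ face_vertices f1) ++ verts t2) ->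
    forall u, u \in n :: face_vertices F -> u \notin verts t2.
  move=> l1 E1 n2 uq12 u; rewrite inE => /orP[/eqP -> //|/(FV _ _ _ l1 E1)].
  exact: disj.
have cnt t1 f1 t2 : (forall u, count_mem u (verts t1 ++ face_vertices f1) + count_mem u (verts t2)
    <= (v == u) + count_mem u (verts a) + count_mem u (verts b) + count_mem u (verts c) + (x == u) + (y == u) + (z == u)) ->
    uniq ((verts t1 ++ face_vertices f1) ++ verts t2).
  by move=> le; apply: uniq_leq_count uq0 => u; have := le u; rewrite /= !count_cat /=; lia.
move: En clos; case: ifP => [ia|/negbT ia]; last case: ifP => [ib|/negbT ib].
- move=> En clos; split=> //.
  + by apply: IHa => //; rewrite mem_cat !inE !negb_or na nv ny nz.
  + by apply: sep_away => //; apply: (away a _ (v, y, z) i) => //; apply: cnt => u; rewrite !count_cat /=; lia.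
  + by apply: sep_away => //; apply: (away a _ (v, y, z) i) => //; apply: cnt => u; rewrite !count_cat /=; lia.
- have -> : i < la + lb by lia.
  move=> En clos; have ib' : i - la < leaves (unlabel b) by lia.
  split=> //.
  + by apply: sep_away => //; apply: (away b _ (x, v, z) (i - la)) => //; apply: cnt => u; rewrite !count_cat /=; lia.
  + by apply: IHb => //; rewrite mem_cat !inE !negb_or nb nv nx nz.
  + by apply: sep_away => //; apply: (away b _ (x, v, z) (i - la)) => //; apply: cnt => u; rewrite !count_cat /=; lia.
- have -> : i < la + lb = false by lia.
  rewrite -subnDA => En clos; have ic' : i - (la + lb) < leaves (unlabel c) by lia.
  split=> //.
  + by apply: sep_away => //; apply: (away c _ (x, y, v) (i - (la + lb))) => //; apply: cnt => u; rewrite !count_cat /=; lia.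
  + by apply: sep_away => //; apply: (away c _ (x, y, v) (i - (la + lb))) => //; apply: cnt => u; rewrite !count_cat /=; lia.
  + by apply: IHc => //; rewrite mem_cat !inE !negb_or nc nv nx ny.
Qed.
End AddVertex.

(* A path changes colour only through a vertex of colour [None]. *)
Lemma path_colors (T C : eqType) (adj : rel T) (col : T -> option C) (p : seq T) :
  (forall u w, adj u w -> [|| ~~ col u, ~~ col w | col u == col w]) ->
  sorted adj p ->
  size (undup (pmap col p)) <= count (fun u => ~~ col u) p + isSome (obind col (ohead p)).
Proof.
move=> adjcol; elim: p => [//|x [_|y p IHp]] /=.
  by case: (col x).
move=> /andP[/adjcol + /IHp] /=.
case: (col x) => [i|] /=; last by case: (col y) => [j|] /=; lia.
case: (col y) => [j|] /=; last by move=> _; case: ifP => _ /=; lia.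
by move=> /eqP[->]; rewrite inE eqxx /=; lia.
Qed.

Lemma find_flatten (T : eqType) (Vs : seq (seq T)) i u :
  uniq (flatten Vs) -> i < size Vs -> u \in nth [::] Vs i ->
  find (fun V => u \in V) Vs = i.
Proof.
elim: Vs i => [|V Vs IH] [|i] //=; first by move=> _ _ ->.
rewrite cat_uniq ltnS => /and3P[_ /hasPn dis uq] lti uVi.
have uf : u \in flatten Vs by apply/flattenP; exists (nth [::] Vs i); rewrite ?mem_nth.
by have := dis _ uf; rewrite /= => /negbTE ->; rewrite (IH i).
Qed.

(** Colour each vertex outside [S] by the list containing it. Adjacent coloured vertices agree, so
    by [path_colors] a path sees at most [(size S).+1] colours, fewer than there are lists. *)
Lemma unvisited (T : eqType) (adj : rel T) (S : seq T) (Vs : seq (seq T)) (p : seq T) :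
  symmetric adj ->
  (forall V u w, V \in Vs -> u \in V -> adj u w -> w \in V ++ S) ->
  uniq (flatten Vs ++ S) -> (size S).+1 < size Vs ->
  uniq p -> sorted adj p ->
  exists2 V, V \in Vs & count [in V] p = 0.
Proof.
move=> adjC cl uq ltS uqp adjp.
suff /hasP[V VVs /eqP V0] : has (fun V => count [in V] p == 0) Vs by exists V.
apply/negPn/negP => /hasPn hit.
(* For a vertex in no list [find] returns [size Vs]: the outside is one further colour. *)
pose col u := if u \in S then None else Some (find (fun V : seq T => u \in V) Vs).
(* One inequality suffices, since [adj] is symmetric. *)
have colle u w : adj u w -> u \notin S -> w \notin S ->
    find (fun V : seq T => w \in V) Vs <= find (fun V : seq T => u \in V) Vs.
  move=> uw uS wS; have [hu|hu] := boolP (has (fun V : seq T => u \in V) Vs); last first.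
    by rewrite (hasNfind hu) find_size.
  have := cl _ _ w (mem_nth [::] _) (nth_find [::] hu) uw.
  rewrite -has_find mem_cat (negbTE wS) orbF => /(_ hu) wV.
  by rewrite leqNgt; apply/negP => /(before_find [::]); rewrite wV.
have adjcol : (forall u w, adj u w -> [|| ~~ col u, ~~ col w | col u == col w]).
  move=> u w uw; rewrite /col; have [//|uS] := boolP (u \in S).
  have [//|wS] := boolP (w \in S); rewrite /=.
  by apply/eqP; congr Some; apply/eqP; rewrite eqn_leq !colle // adjC.
have := path_colors adjcol adjp.
have : size Vs <= size (undup (pmap col p)).
  rewrite -(size_iota 0 (size Vs)); apply: uniq_leq_size; first exact: iota_uniq.
  move=> i; rewrite mem_iota /= add0n => lti; rewrite mem_undup mem_pmap.
  have := hit _ (mem_nth [::] lti); rewrite -lt0n -has_count => /hasP[u up /= uV].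
  apply/mapP; exists u => //; rewrite /col.
  move: uq; rewrite cat_uniq => /and3P[uqf /hasPn dis _].
  rewrite (find_flatten uqf lti uV) ifN //; apply/negP => /dis /negP; apply.
  by apply/flattenP; exists (nth [::] Vs i); rewrite ?mem_nth.
have : count (fun u => ~~ col u) p <= size S.
  rewrite -size_filter; apply: uniq_leq_size; first exact: filter_uniq.
  by move=> u; rewrite mem_filter /col; case: (u \in S).
move=> leS leVs lesz; have := leq_trans ltS (leq_trans leVs lesz).
by rewrite ltnNge -[(size S).+1]addn1 leq_add // leq_b1.
Qed.

(** * Vertices of a path inside a face *)

Definition hits (p s : seq nat) : nat := count [in s] p.

Lemma hits_cat (p s1 s2 : seq nat) : hits p (s1 ++ s2) <= hits p s1 + hits p s2.
Proof.
rewrite /hits; elim: p => //= x q IH; rewrite mem_cat.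
by case: (x \in s1); case: (x \in s2) => /=; lia.
Qed.

Lemma hits_uniq (p s : seq nat) : uniq p -> hits p s <= size s.
Proof.
move=> uqp.
rewrite /hits -size_filter; apply: uniq_leq_size; first exact: filter_uniq.
by move=> u; rewrite mem_filter => /andP[].
Qed.

Section PathBound.
Variables (adj : rel nat) (p : seq nat).
Hypotheses (adjC : symmetric adj) (uqp : uniq p) (adjp : sorted adj p).


Lemma hits_node v a b c : hits p (verts (LNode v a b c)) <=
  (hits p (verts a) + hits p (verts b) + hits p (verts c)).+1.
Proof.
rewrite [verts _]/= -cat1s; apply: leq_trans (hits_cat _ _ _) _.
have := hits_uniq [:: v] uqp.
have := hits_cat p (verts a) (verts b ++ verts c).
have := hits_cat p (verts b) (verts c).
rewrite [size _]/=; lia.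
Qed.

Definition unhit_child (t : ltree) : bool :=
  if t is LNode _ a b c then [|| hits p (verts a) == 0, hits p (verts b) == 0 | hits p (verts c) == 0] else false.

(* The seven vertices of the face and of the first two subdivisions cut the path
   into at most eight pieces, each inside one grandchild or outside. *)
Lemma unhit_grandchild v a b c f :
  sep adj (LNode v a b c) f -> uniq (verts (LNode v a b c) ++ face_vertices f) ->
  [|| unhit_child a, unhit_child b, unhit_child c |
      minn (minsurv (unlabel a)) (minn (minsurv (unlabel b)) (minsurv (unlabel c))) == 0].
Proof.
(* If a child is not subdivided, the minimum to be discarded is zero and nothing has to be
   missed. *)
case: a => [|va a1 a2 a3]; first by rewrite min0n eqxx !orbT.
case: b => [|vb b1 b2 b3]; first by rewrite min0n minn0 eqxx !orbT.
case: c => [|vc c1 c2 c3]; first by rewrite !minn0 eqxx !orbT.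
case: f => [[x y] z] [_ [_ sa1 sa2 sa3] [_ sb1 sb2 sb3] [_ sc1 sc2 sc3]] uq.
have := @unvisited _ adj [:: x; y; z; v; va; vb; vc]
  [:: verts a1; verts a2; verts a3; verts b1; verts b2; verts b3; verts c1; verts c2; verts c3]
  p adjC _ _ _ uqp adjp.
case=> //.
- move=> V u w; rewrite !inE => VVs uV uw.
  suff : w \in V ++ [:: x; y; z; v; va; vb; vc] by [].
  do ?[case/orP: VVs => VVs]; move/eqP: VVs uV => -> uV;
  [have := sep_closed sa1 uV uw | have := sep_closed sa2 uV uw | have := sep_closed sa3 uV uw
  |have := sep_closed sb1 uV uw | have := sep_closed sb2 uV uw | have := sep_closed sb3 uV uw
  |have := sep_closed sc1 uV uw | have := sep_closed sc2 uV uw | have := sep_closed sc3 uV uw];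
  rewrite !mem_cat !inE => /orP[->//|/or3P[]/eqP->]; by rewrite eqxx ?orbT.
- apply: uniq_leq_count uq => u; do 4!rewrite /= ?(count_cat, cats0); lia.
move=> V; rewrite !inE => VVs V0; rewrite /unhit_child /hits.
by do ?[case/orP: VVs => VVs]; move: V0; rewrite (eqP VVs) => ->; rewrite eqxx ?orbT.
Qed.

(** The three bounds need a joint induction. The third one records the saving: a missed child
    contributes no hit, while its [surv], which is at least [minsurv] of the parent, is counted in
    [surv1]. *)
Lemma hits_prune t f : sep adj t f -> uniq (verts t ++ face_vertices f) ->
  [/\ hits p (verts t) <= surv (unlabel t), hits p (verts t) <= surv1 (unlabel t) &
      unhit_child t -> hits p (verts t) + minsurv (unlabel t) <= surv1 (unlabel t)].
Proof.
elim: t f => [|v a IHa b IHb c IHc] f st uq.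
  by split => //; rewrite /hits /= (eq_count (a2 := pred0)) ?count_pred0.
have := hits_node v a b c; have := unhit_grandchild st uq.
case: f st uq => [[x y] z] [cl sa sb sc] uq.
have [|{}IHa IHa1 IHa2] := IHa _ sa.
  by apply: uniq_leq_count uq => u; rewrite /= !count_cat /=; lia.
have [|{}IHb IHb1 IHb2] := IHb _ sb.
  by apply: uniq_leq_count uq => u; rewrite /= !count_cat /=; lia.
have [|{}IHc IHc1 IHc2] := IHc _ sc.
  by apply: uniq_leq_count uq => u; rewrite /= !count_cat /=; lia.
have [? ? ?] := And3 (minsurv_le (unlabel a)) (minsurv_le (unlabel b)) (minsurv_le (unlabel c)).
move=> unhit le; rewrite [unlabel _]/= survN surv1N minsurvN; split.
- by case/or4P: unhit => [/IHa2|/IHb2|/IHc2|/eqP]; lia.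
- by lia.
- by rewrite /unhit_child => /or3P[]/eqP; lia.
Qed.
End PathBound.

(** * The tree of a history *)

Fixpoint history_ltree (k : nat) : ran_history k -> ltree :=
  if k is k'.+1 return ran_history k -> ltree then
    fun h => lgrow k'.+3 (history_ltree h.1) h.2
  else fun=> LLeaf.

Fixpoint history_tree (k : nat) : ran_history k -> tree :=
  if k is k'.+1 return ran_history k -> tree then
    fun h => grow (history_tree h.1) h.2
  else fun=> Leaf.

Lemma unlabel_history k (h : ran_history k) : unlabel (history_ltree h) = history_tree h.
Proof. by elim: k h => //= k IH [h i] /=; rewrite unlabel_lgrow IH. Qed.

Lemma size_history k (h : ran_history k) : tree_size (history_tree h) = k.
Proof. by elim: k h => //= k IH [h i] /=; rewrite tree_size_grow IH. Qed.

Lemma leaves_history k (h : ran_history k) : leaves (history_tree h) = k.*2.+1.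
Proof. by rewrite leavesE size_history. Qed.

Lemma ran_facesE k (h : ran_history k) : ran_faces h = leaf_faces (history_ltree h) (0, 1, 2).
Proof.
elim: k h => //= k IH [h i] /=; rewrite IH leaf_faces_lgrow //.
by rewrite unlabel_history leaves_history.
Qed.

Lemma verts_history k (h : ran_history k) : perm_eq (verts (history_ltree h)) (iota 3 k).
Proof.
elim: k h => // k IH [h i]; rewrite (permPl (verts_lgrow _ _ _)).
rewrite (_ : iota 3 k.+1 = rcons (iota 3 k) k.+3); last by rewrite -[in LHS](addn1 k) iotaD cats1.
by rewrite perm_sym perm_rcons perm_cons perm_sym IH.
Qed.

Lemma ran_adjC k (h : ran_history k) : symmetric (ran_adj h).
Proof.
elim: k h => [|k IH] h u v /=; first by rewrite eq_sym [(v < 3) && _]andbC.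
by rewrite IH [(u == _) && _ || _]orbC.
Qed.

Lemma verts_uniq k (h : ran_history k) :
  perm_eq (verts (history_ltree h) ++ [:: 0; 1; 2]) (iota 0 k.+3).
Proof.
rewrite -[k.+3]/(3 + k) iotaD perm_catC perm_cat2l; exact: verts_history.
Qed.

(** This makes [k.+3] a fresh vertex at the next step, as [sep_lgrow] requires. *)
Lemma ran_adj_lt k (h : ran_history k) u v : ran_adj h u v -> u < k.+3.
Proof.
elim: k h u v => [|k IH] h u v /=; first by case/and3P.
case/or3P => [/IH|/andP[/eqP-> _]//|/andP[_]]; first by move/ltnW.
rewrite ran_facesE => uF.
suff : u \in iota 0 k.+3 by rewrite mem_iota => /andP[_] /ltnW.
rewrite -(perm_mem (verts_uniq h.1)); apply: (@leaf_faces_verts _ (0, 1, 2)) uF.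
by rewrite mem_nth // size_leaf_faces unlabel_history leaves_history.
Qed.

Lemma sep_history k (h : ran_history k) : sep (ran_adj h) (history_ltree h) (0, 1, 2).
Proof.
elim: k h => //= k IH [h i]; rewrite ran_facesE.
apply: sep_lgrow => /=.
- by move=> u; apply/negP => /ran_adj_lt; rewrite ltnn.
- by rewrite unlabel_history leaves_history.
- by rewrite (perm_uniq (verts_uniq h)) iota_uniq.
- by rewrite (perm_mem (verts_uniq h)) mem_iota /= ltnn.
- exact: IH.
Qed.

(** The additive three pays for the corners of the initial triangle; all other vertices are
    interior. *)
Lemma longest_path_surv k (h : ran_history k) :
  longest_path (ran_graph h) <= (surv (history_tree h)).+3.
Proof.
apply/bigmax_leqP => l /existsP[p /andP[uqp adjp]].
pose q := map val p.
have uqq : uniq q by rewrite map_inj_uniq //; exact: val_inj.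
have adjq : sorted (ran_adj h) q by rewrite sorted_map.
have [hits_le _ _] := hits_prune (@ran_adjC _ h) uqq adjq (sep_history h) (etrans (perm_uniq (verts_uniq h)) (iota_uniq _ _)).
have -> : l = size q :> nat by rewrite size_map size_tuple.
have <- : hits q (verts (history_ltree h) ++ [:: 0; 1; 2]) = size q.
  apply/eqP; rewrite -all_count; apply/allP => u /mapP[w _ ->] /=.
  by rewrite (perm_mem (verts_uniq h)) mem_iota /=.
apply: leq_trans (hits_cat _ _ _) _.
have := hits_uniq [:: 0; 1; 2] uqq; rewrite -unlabel_history [size _]/=; lia.
Qed.

Local Open Scope classical_set_scope.
Local Open Scope ring_scope.

(** * The uniform measure on histories and the Polya urn *)

Section Mean.
Variable R : realType.
Implicit Types (k : nat) (phi psi : tree -> R).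

Definition mean k phi : R :=
  (\sum_(h : ran_history k) phi (history_tree h)) / #|ran_history k|%:R.

Lemma card_historyS k : #|ran_history k.+1| = (#|ran_history k| * k.*2.+1)%N.
Proof. by rewrite card_prod card_ord. Qed.

Lemma card_history_gt0 k : (0 < #|ran_history k|)%N.
Proof. by elim: k => [|k IH]; rewrite ?card_unit // card_historyS muln_gt0 IH. Qed.

Lemma le_mean k phi psi : (forall t, tree_size t = k -> phi t <= psi t) ->
  mean k phi <= mean k psi.
Proof.
move=> le; rewrite ler_wpM2r ?invr_ge0 ?ler0n // ler_sum // => h _.
exact/le/size_history.
Qed.

Lemma eq_mean k phi psi : (forall t, tree_size t = k -> phi t = psi t) ->
  mean k phi = mean k psi.
Proof. by move=> e; apply/le_anti; rewrite !le_mean // => t /e ->. Qed.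

Lemma mean_cst k (c : R) : mean k (fun=> c) = c.
Proof.
rewrite /mean sumr_const -[c *+ _]mulr_natr mulfK //.
by rewrite pnatr_eq0 -lt0n card_history_gt0.
Qed.

Lemma meanD k phi psi : mean k (fun t => phi t + psi t) = mean k phi + mean k psi.
Proof. by rewrite /mean big_split mulrDl. Qed.

Lemma meanZ k c phi : mean k (fun t => c * phi t) = c * mean k phi.
Proof. by rewrite /mean -mulr_sumr mulrA. Qed.

Lemma meanZr k c phi : mean k (fun t => phi t * c) = mean k phi * c.
Proof. by rewrite /mean -mulr_suml mulrAC. Qed.

Lemma mean_sum k (I : finType) (F : I -> tree -> R) :
  mean k (fun t => \sum_i F i t) = \sum_i mean k (F i).
Proof. by rewrite /mean exchange_big /= mulr_suml. Qed.

Lemma mean_ge0 k phi : (forall t, 0 <= phi t) -> 0 <= mean k phi.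
Proof. by move=> ge0; rewrite -(mean_cst k 0) le_mean. Qed.

Lemma mean0 phi : mean 0 phi = phi Leaf.
Proof.
rewrite /mean card_unit divr1 (eq_bigr (fun=> phi Leaf)) //.
by rewrite sumr_const card_unit.
Qed.

(** Conditioning on all steps but the last. *)
Lemma meanS k phi : mean k.+1 phi =
  mean k (fun t => \sum_(i < k.*2.+1) phi (grow t i)) / (k.*2.+1)%:R.
Proof.
rewrite /mean card_historyS natrM invfM mulrA.
by rewrite pair_bigA.
Qed.

(** * Independent subtrees and the law of their sizes *)

Definition mean3 a b c (f : tree -> tree -> tree -> R) : R :=
  mean a (fun x => mean b (fun y => mean c (f x y))).

Lemma eq_mean3 a b c f g : (forall x y z,
    tree_size x = a -> tree_size y = b -> tree_size z = c -> f x y z = g x y z) ->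
  mean3 a b c f = mean3 a b c g.
Proof.
move=> e; apply: eq_mean => x xa; apply: eq_mean => y yb; apply: eq_mean => z zc.
exact: e.
Qed.

Lemma mean3D a b c f g : mean3 a b c (fun x y z => f x y z + g x y z) =
  mean3 a b c f + mean3 a b c g.
Proof.
rewrite /mean3 -meanD; apply: eq_mean => x _; rewrite -meanD.
by apply: eq_mean => y _; rewrite -meanD.
Qed.

Lemma mean3Zr a b c r f : mean3 a b c (fun x y z => f x y z * r) = mean3 a b c f * r.
Proof.
rewrite /mean3 -meanZr; apply: eq_mean => x _; rewrite -meanZr.
by apply: eq_mean => y _; rewrite -meanZr.
Qed.

Lemma mean3_sum a b c F G H :
  mean3 a b c (fun x y z => F x + G y + H z) = mean a F + mean b G + mean c H.
Proof.
rewrite !mean3D /mean3; congr (_ + _ + _); rewrite ?mean_cst //.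
- by apply: eq_mean => x _; rewrite !mean_cst.
- by apply: eq_mean => x _; rewrite mean_cst.
Qed.

Lemma mean3_prod a b c F G H :
  mean3 a b c (fun x y z => F x * G y * H z) = mean a F * mean b G * mean c H.
Proof.
rewrite /mean3 -!meanZr; apply: eq_mean => x _.
rewrite -mulrA -!meanZr -meanZ; apply: eq_mean => y _.
by rewrite meanZ mulrA.
Qed.

Lemma mean3_growl a b c f :
  mean3 a b c (fun x y z => \sum_(i < a.*2.+1) f (grow x i) y z) =
  (a.*2.+1)%:R * mean3 a.+1 b c f.
Proof.
rewrite {2}/mean3 meanS [RHS]mulrC mulfVK ?pnatr_eq0 //.
apply: eq_mean => x _; rewrite -mean_sum; apply: eq_mean => y _.
by rewrite mean_sum.
Qed.

Lemma mean3_growm a b c f :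
  mean3 a b c (fun x y z => \sum_(i < b.*2.+1) f x (grow y i) z) =
  (b.*2.+1)%:R * mean3 a b.+1 c f.
Proof.
rewrite {2}/mean3 -meanZ; apply: eq_mean => x _.
rewrite meanS [RHS]mulrC mulfVK ?pnatr_eq0 //.
by apply: eq_mean => y _; rewrite mean_sum.
Qed.

Lemma mean3_growr a b c f :
  mean3 a b c (fun x y z => \sum_(i < c.*2.+1) f x y (grow z i)) =
  (c.*2.+1)%:R * mean3 a b c.+1 f.
Proof.
rewrite {2}/mean3 -meanZ; apply: eq_mean => x _.
rewrite -meanZ; apply: eq_mean => y _.
by rewrite meanS [RHS]mulrC mulfVK ?pnatr_eq0.
Qed.

Implicit Types (w : nat -> nat -> nat -> R).

(* One backward step of the urn that counts the insertions in the three faces of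
   the first subdivision: a face with [a] insertions contains [2a + 1] faces. *)
Definition polya_step w a b c : R :=
  ((a.*2.+1)%:R * w a.+1 b c + (b.*2.+1)%:R * w a b.+1 c + (c.*2.+1)%:R * w a b c.+1)
  / ((a + b + c).*2.+3)%:R.

(** Expectation of [w] at the state of the urn after [k] steps from the origin. Each step acts on
    the function [w], so the law itself is never written down. *)
Fixpoint polya k w : R := if k is k'.+1 then polya k' (polya_step w) else w 0 0 0.

Lemma le_polya k w w' : (forall a b c, (a + b + c)%N = k -> w a b c <= w' a b c) ->
  polya k w <= polya k w'.
Proof.
elim: k w w' => [|k IH] w w' le /=; first exact: le.
apply: IH => a b c abc; rewrite ler_wpM2r ?invr_ge0 ?ler0n //.
by rewrite !lerD // ler_wpM2l ?ler0n // le //; lia.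
Qed.

Lemma eq_polya k w w' : (forall a b c, (a + b + c)%N = k -> w a b c = w' a b c) ->
  polya k w = polya k w'.
Proof. by move=> e; apply/le_anti; rewrite !le_polya // => a b c /e ->. Qed.

Lemma polyaD k w w' : polya k (fun a b c => w a b c + w' a b c) = polya k w + polya k w'.
Proof.
elim: k w w' => [//|k IH] w w' /=; rewrite -IH; apply: eq_polya => a b c _.
by rewrite /polya_step -mulrDl; congr (_ / _); ring.
Qed.

Lemma polyaZ k r w : polya k (fun a b c => r * w a b c) = r * polya k w.
Proof.
elim: k w => [//|k IH] w /=; rewrite -IH; apply: eq_polya => a b c _.
by rewrite /polya_step [RHS]mulrA; congr (_ / _); ring.
Qed.

Lemma polya_cst k r : polya k (fun _ _ _ => r) = r.
Proof.
elim: k => [//|k IH] /=; rewrite -[RHS]IH; apply: eq_polya => a b c _.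
rewrite /polya_step -!mulrDl -!natrD (_ : (_ + _ + _)%N = (a + b + c).*2.+3); last lia.
by rewrite mulrAC divff ?mul1r // pnatr_eq0.
Qed.

Lemma polya_cstB k r w : polya k (fun a b c => r - w a b c) = r - polya k w.
Proof.
apply/eqP; rewrite eq_sym subr_eq -polyaD -[X in X == _](polya_cst k r).
by apply/eqP/eq_polya => a b c _; rewrite subrK.
Qed.

Lemma polya_sum k (I : finType) (F : I -> nat -> nat -> nat -> R) :
  polya k (fun a b c => \sum_i F i a b c) = \sum_i polya k (F i).
Proof.
elim: k F => [//|k IH] F /=; rewrite -IH; apply: eq_polya => a b c _.
by rewrite /polya_step !mulr_sumr -!big_split /= mulr_suml.
Qed.

(** A uniform leaf falls in each subtree with probability proportional to its number of leaves and
    is uniform there. Hence the sizes follow the urn and, given the sizes, the subtrees are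
    independent. *)
Lemma mean_node k phi : mean k.+1 phi =
  polya k (fun a b c => mean3 a b c (fun x y z => phi (Node x y z))).
Proof.
elim: k phi => [|k IH] phi.
  by rewrite meanS mean0 big_ord1 divr1 /= /mean3 !mean0.
rewrite meanS -meanZr {}IH /=; apply: eq_polya => a b c abc.
rewrite /polya_step -mean3_growl -mean3_growm -mean3_growr -!mean3D.
rewrite mean3Zr abc doubleS; congr (_ / _).
apply: eq_mean3 => x y z xa yb zc.
(* The leaf indices split into three consecutive ranges, matching the branches of [grow]. *)
have -> : k.*2.+3 = (leaves x + leaves y + leaves z)%N by rewrite !leavesE; lia.
rewrite !big_split_ord /= -xa -yb -zc -!leavesE.
congr (_ + _ + _); apply: eq_bigr => i _ /=.
- by rewrite ltn_ord.
- by rewrite ltnNge leq_addr /= ltn_add2l ltn_ord addKn.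
- by rewrite !ltnNge leq_addr -addnA leq_addr addnA /= addKn.
Qed.

Definition point_mass (a b c x y z : nat) : R := ([&& x == a, y == b & z == c])%:R.

(* [1 / (4k^2 - 1)], written here at [k + 1], is exactly preserved by the urn:
   the total weight [2(a + b + c) - 3] of the predecessors of [(a, b, c)] is the
   numerator of the ratio of consecutive bounds. *)
Lemma polya_point_mass k a b c : (a + b + c = k.+1)%N ->
  ((k.*2.+1 * k.*2.+3)%:R)^-1 <= polya k.+1 (point_mass a b c).
Proof.
elim: k a b c => [|k IH] a b c abc.
  rewrite /= /polya_step /point_mass /=.
  case: a b c abc => [|[|a]] [|[|b]] [|[|c]] //= _; rewrite ?mulr0 ?mulr1 ?addr0 ?add0r mul1r; exact: lexx.
rewrite -[polya k.+2 _]/(polya k.+1 (polya_step (point_mass a b c))).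
set w := ((k.*2.+1 * k.*2.+3)%:R)^-1 in IH *.
have w0 : 0 <= w by rewrite invr_ge0.
(* The predecessor with one insertion fewer in the first face has [2a - 1] faces there. For [a = 0]
   there is no predecessor, and the bound is trivial because its left side is not positive. *)
have Ta : (a%:R *+ 2 - 1) * w <= polya k.+1 (fun x y z => (x.*2.+1)%:R * point_mass a b c x.+1 y z).
  case: a abc => [|a] abc.
    rewrite (@eq_polya _ _ (fun _ _ _ => 0)) => [|x y z _]; last by rewrite /point_mass mulr0.
    rewrite polya_cst; lra.
  rewrite (@eq_polya _ _ (fun x y z => (a.*2.+1)%:R * point_mass a b c x y z)) => [|x y z _]; last first.
    by rewrite /point_mass eqSS; case: eqP => [->|_] //=; rewrite !mulr0.
  rewrite polyaZ (_ : _ - _ = (a.*2.+1)%:R); last by rewrite -[a.*2.+1]addn1 -muln2 natrD natrM -[a.+1]addn1 natrD; ring.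
  by rewrite ler_wpM2l // IH //; lia.
have Tb : (b%:R *+ 2 - 1) * w <= polya k.+1 (fun x y z => (y.*2.+1)%:R * point_mass a b c x y.+1 z).
  case: b abc {Ta} => [|b] abc.
    rewrite (@eq_polya _ _ (fun _ _ _ => 0)) => [|x y z _]; last by rewrite /point_mass andbF mulr0.
    rewrite polya_cst; lra.
  rewrite (@eq_polya _ _ (fun x y z => (b.*2.+1)%:R * point_mass a b c x y z)) => [|x y z _]; last first.
    by rewrite /point_mass eqSS; case: (y =P b) => [->|_] //=; rewrite !andbF !mulr0.
  rewrite polyaZ (_ : _ - _ = (b.*2.+1)%:R); last by rewrite -[b.*2.+1]addn1 -muln2 natrD natrM -[b.+1]addn1 natrD; ring.
  by rewrite ler_wpM2l // IH //; lia.
have Tc : (c%:R *+ 2 - 1) * w <= polya k.+1 (fun x y z => (z.*2.+1)%:R * point_mass a b c x y z.+1).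
  case: c abc {Ta Tb} => [|c] abc.
    rewrite (@eq_polya _ _ (fun _ _ _ => 0)) => [|x y z _]; last by rewrite /point_mass !andbF mulr0.
    rewrite polya_cst; lra.
  rewrite (@eq_polya _ _ (fun x y z => (c.*2.+1)%:R * point_mass a b c x y z)) => [|x y z _]; last first.
    by rewrite /point_mass eqSS; case: (z =P c) => [->|_] //=; rewrite !andbF !mulr0.
  rewrite polyaZ (_ : _ - _ = (c.*2.+1)%:R); last by rewrite -[c.*2.+1]addn1 -muln2 natrD natrM -[c.+1]addn1 natrD; ring.
  by rewrite ler_wpM2l // IH //; lia.
rewrite (@eq_polya _ (polya_step _) (fun x y z => ((k.+1).*2.+3)%:R^-1 * (
   (x.*2.+1)%:R * point_mass a b c x.+1 y z + (y.*2.+1)%:R * point_mass a b c x y.+1 z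
     + (z.*2.+1)%:R * point_mass a b c x y z.+1))); last first.
  by move=> x y z xyz; rewrite /polya_step xyz [RHS]mulrC.
rewrite polyaZ !polyaD.
have abcR : a%:R + b%:R + c%:R = k%:R + 2 :> R by rewrite -!natrD abc -addn2.
apply: (@le_trans _ _ (((k.+1).*2.+3)%:R^-1 * ((k.*2.+1)%:R * w))); last first.
  rewrite ler_wpM2l ?invr_ge0 //.
  have -> : (k.*2.+1)%:R = (k%:R *+ 2 + 1) :> R by rewrite -[k.*2.+1]addn1 -muln2 natrD natrM; ring.
  have -> : (k%:R *+ 2 + 1) * w = (a%:R *+ 2 - 1) * w + (b%:R *+ 2 - 1) * w + (c%:R *+ 2 - 1) * w.
    by rewrite (_ : k%:R = a%:R + b%:R + c%:R - 2); [ring | rewrite abcR; ring].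
  lra.
have -> : (k.*2.+1)%:R * w = ((k.*2.+3)%:R)^-1.
  by rewrite /w natrM invfM mulrA divff ?mul1r // pnatr_eq0.
by rewrite doubleS natrM invfM mulrC.
Qed.

Lemma sum_eq_range n x : \sum_(i < n) (x == n + i)%N%:R = (n <= x < n + n)%N%:R :> R.
Proof.
case: (boolP (n <= x < n + n)%N) => [/andP[nx xn]|H].
  have lt : (x - n < n)%N by lia.
  rewrite (bigD1 (Ordinal lt)) //= subnKC // eqxx big1 ?addr0 // => i.
  rewrite -val_eqE /= => ne; rewrite (_ : (_ == _) = false) //; lia.
by rewrite big1 // => i _; rewrite (_ : (_ == _) = false) //; have := ltn_ord i; lia.
Qed.

(** The box holds [n^2] states, the third coordinate being determined and nonnegative as [4n <= k].
    By [polya_point_mass] each has mass at least [1 / (2k)^2]. *)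
Lemma polya_box k n w (m : R) : (0 < k)%N -> (n.*2.*2 <= k)%N -> 0 <= m ->
  (forall a b c, (a + b + c)%N = k -> 0 <= w a b c) ->
  (forall a b c, (a + b + c)%N = k -> (n <= a < n + n)%N -> (n <= b < n + n)%N -> m <= w a b c) ->
  m * (n%:R / (k%:R *+ 2)) ^+ 2 <= polya k w.
Proof.
case: k => // k _ nk m0 w0 wm.
apply: (@le_trans _ _ (polya k.+1 (fun x y z => \sum_(i < n) \sum_(j < n)
    m * point_mass (n + i) (n + j) (k.+1 - (n + i) - (n + j)) x y z))); last first.
  apply: le_polya => x y z xyz.
  apply: (@le_trans _ _ (\sum_(i < n) \sum_(j < n) m * ((x == n + i)%N%:R * (y == n + j)%N%:R))).
    apply: ler_sum => i _; apply: ler_sum => j _; rewrite ler_wpM2l // /point_mass.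
    by case: (_ == _); case: (_ == _); case: (_ == _); rewrite /= ?mulr0 ?mul0r ?mulr1.
  under eq_bigr do rewrite -mulr_sumr -mulr_sumr sum_eq_range.
  rewrite -mulr_sumr -mulr_suml sum_eq_range.
  case: (boolP (n <= x < n + n)%N) => [hx|_]; last by rewrite mul0r mulr0 w0.
  case: (boolP (n <= y < n + n)%N) => [hy|_]; last by rewrite !mulr0 w0.
  by rewrite !mulr1 wm.
rewrite polya_sum.
under eq_bigr => i _ do rewrite polya_sum.
apply: (@le_trans _ _ (\sum_(i < n) \sum_(j < n) m * ((k.*2.+1 * k.*2.+3)%:R)^-1)); last first.
  apply: ler_sum => i _; apply: ler_sum => j _; rewrite polyaZ ler_wpM2l // polya_point_mass //.
  by have := ltn_ord i; have := ltn_ord j; lia.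
rewrite !sumr_const !card_ord -mulrnA -[leRHS]mulr_natr -mulrA ler_wpM2l //.
rewrite expr_div_n mulrC -natrX -mulnn ler_wpM2r //.
rewrite lef_pV2 ?posrE ?exprn_gt0 ?pmulrn_lgt0 ?ltr0n //.
have -> : (k.+1%:R *+ 2) ^+ 2 = ((k.+1).*2 ^ 2)%:R :> R by rewrite natrX -muln2 natrM; ring.
by rewrite ler_nat; lia.
Qed.
End Mean.

(** * The expected number of surviving nodes *)

Section MeanSurv.
Variable R : realType.

Definition mean_surv k : R := mean k (fun t => (surv t)%:R).
Definition mean_surv1 k : R := mean k (fun t => (surv1 t)%:R).

(** The amount subtracted in [survN], isolated as the gain over the linear recursion. *)
Definition pruned (t : tree) : nat :=
  if t is Node a b c then minn (minsurv a) (minn (minsurv b) (minsurv c)) else 0%N.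

Lemma mean_surv_le k : mean_surv k <= k%:R.
Proof.
rewrite -[leRHS](mean_cst k); apply: le_mean => t <-.
by rewrite ler_nat; have /andP[] := surv_le_size t.
Qed.

Lemma mean_surv1_0 : mean_surv1 0 = 0.
Proof. by rewrite /mean_surv1 mean0. Qed.

Lemma mean_surv1S k : mean_surv1 k.+1 =
  polya k (fun a b c => mean_surv a + mean_surv b + mean_surv c) + 1.
Proof.
rewrite /mean_surv1 mean_node -[X in _ = _ + X](polya_cst k) -polyaD.
apply: eq_polya => a b c _; rewrite -mean3_sum.
rewrite -[X in _ = _ + X](mean_cst a (1 : R)).
have -> : mean a (fun=> 1) = mean3 a b c (fun _ _ _ => 1 : R).
  by rewrite /mean3; apply: eq_mean => x _; rewrite !mean_cst.
rewrite -mean3D; apply: eq_mean3 => x y z _ _ _.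
by rewrite surv1N -addn1 !natrD.
Qed.

Lemma mean_survS k : mean_surv k.+1 =
  polya k (fun a b c => mean_surv1 a + mean_surv1 b + mean_surv1 c) + 1
    - mean k.+1 (fun t => (pruned t)%:R).
Proof.
apply/eqP; rewrite eq_sym subr_eq eq_sym; apply/eqP.
rewrite -meanD mean_node -[X in _ = _ + X](polya_cst k) -polyaD.
apply: eq_polya => a b c _; rewrite -mean3_sum.
rewrite -[X in _ = _ + X](mean_cst a (1 : R)).
have -> : mean a (fun=> 1) = mean3 a b c (fun _ _ _ => 1 : R).
  by rewrite /mean3; apply: eq_mean => x _; rewrite !mean_cst.
rewrite -mean3D; apply: eq_mean3 => x y z _ _ _.
have le : (pruned (Node x y z) <= (surv1 x + surv1 y + surv1 z).+1)%N.
  by rewrite /pruned; have := minsurv_le x; lia.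
by rewrite -natrD survN (subnK le) -addn1 !natrD.
Qed.

(** One more step grows one leaf. This carries an estimate at one size over to all larger sizes. *)
Lemma mean_grow k k' (phi : tree -> R) : (forall t i, phi t <= phi (grow t i)) ->
  (k <= k')%N -> mean k phi <= mean k' phi.
Proof.
move=> mono /subnK <-; elim: (k' - k)%N => [//|d IH]; apply: le_trans IH _.
rewrite addSn meanS ler_pdivlMr ?ltr0n // -meanZr; apply: le_mean => t _.
rewrite -[X in _ * X]/((_.*2.+1)%:R) mulr_natr -[X in _ *+ X]card_ord -sumr_const.
by apply: ler_sum.
Qed.

(** A lower bound for the mass of a box of side [n]: if [k <= 110 n] then [n / (2k) >= 1 / 220]. *)
Definition alpha : R := locked ((1 / 220) ^+ 2).

Lemma alpha_gt0 : 0 < alpha. Proof. by rewrite /alpha -lock exprn_gt0 // divr_gt0. Qed.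
Lemma alpha_le1 : alpha <= 1. Proof. rewrite /alpha -lock; nra. Qed.

Lemma polya_box_alpha k n w (m : R) : (0 < n)%N -> (n.*2.*2 <= k <= 110 * n)%N -> 0 <= m ->
  (forall a b c, (a + b + c)%N = k -> 0 <= w a b c) ->
  (forall a b c, (a + b + c)%N = k -> (n <= a < n + n)%N -> (n <= b < n + n)%N -> m <= w a b c) ->
  m * alpha <= polya k w.
Proof.
move=> n0 /andP[nk kn] m0 w0 wm; have k0 : (0 < k)%N by lia.
apply: le_trans (polya_box k0 nk m0 w0 wm); rewrite /alpha -lock ler_wpM2l // lerXn2r ?nnegrE //.
have : k%:R <= 110 * n%:R :> R by rewrite -natrM ler_nat.
have : 0 < k%:R :> R by rewrite ltr0n.
rewrite ler_pdivlMr ?pmulrn_lgt0 ?ltr0n // => ? ?; lra.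
Qed.

Lemma natr3 (rho C : R) (a b c k : nat) : (a + b + c)%N = k ->
  (rho * a%:R + C) + (rho * b%:R + C) + (rho * c%:R + C) = rho * k%:R + 3 * C.
Proof. by move=> <-; rewrite !natrD; ring. Qed.

(** * One improvement of a linear bound on [mean_surv] *)

Section Step.
Variables (rho C : R).
Hypotheses (rho_gt0 : 0 < rho) (rho_le1 : rho <= 1).
Hypothesis survC : forall k, mean_surv k <= rho * k%:R + C.

Lemma survC_ge0 : 0 <= C.
Proof.
have := survC 0; rewrite mulr0 add0r; apply: le_trans.
by rewrite mean_ge0.
Qed.

(** Three children cost [3 * C] and the root one node; one level higher the same count gives
    [9 * C + 4]. *)
Lemma surv1C k : mean_surv1 k <= rho * k%:R + (3 * C + 1).
Proof.
have := survC_ge0; case: k => [|k]; first by rewrite mean_surv1_0 mulr0; lra.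
rewrite mean_surv1S => C0.
suff : polya k (fun a b c => mean_surv a + mean_surv b + mean_surv c) <= rho * k%:R + 3 * C.
  have : rho * k%:R <= rho * k.+1%:R by rewrite ler_pM2l // ler_nat.
  lra.
rewrite -(polya_cst k (_ + _)); apply: le_polya => a b c abc.
by rewrite -(natr3 _ _ abc) !lerD.
Qed.

(* If no size in [n, 2n) is nearly extremal for the bound [survC], then the bound
   improves because some grandchild has such a size with positive probability. *)
Lemma surv_drop_deficient n k : (0 < n)%N -> (55 * n <= k <= 110 * n)%N ->
  (forall j, (n <= j < n + n)%N -> mean_surv j <= rho / 2 * j%:R) ->
  mean_surv k.+1 <= rho * k%:R + 9 * C + 4 - rho / 2 * n%:R * alpha ^+ 2.
Proof.
move=> n0 /andP[nk kn] low; have a0 := alpha_gt0; have C0 := survC_ge0.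
have nR : 0 < n%:R :> R by rewrite ltr0n.
(* With probability at least [alpha] the first child has size in [[n, 2n)], where the deficit is at
   least [rho / 2 * n]. *)
have def1 i : (n.*2.*2 <= i <= 110 * n)%N ->
    mean_surv1 i.+1 <= rho * i.+1%:R + (3 * C + 1) - rho / 2 * n%:R * alpha.
  move=> ni; rewrite mean_surv1S.
  have : rho * i%:R <= rho * i.+1%:R by rewrite ler_pM2l // ler_nat.
  suff : rho / 2 * n%:R * alpha <= polya i (fun a b c => (rho * i%:R + 3 * C) -
       (mean_surv a + mean_surv b + mean_surv c)).
    rewrite (polya_cstB _ _ (fun a b c => mean_surv a + mean_surv b + mean_surv c)); lra.
  apply: (polya_box_alpha n0 ni).
  - by rewrite mulr_ge0 // ltW // divr_gt0.
  - move=> a b c /(natr3 rho C) <-; have := survC a; have := survC b; have := survC c; lra.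
  - move=> a b c /(natr3 rho C) <- na _; have := low a na; have := survC b; have := survC c.
    have : rho / 2 * n%:R <= rho / 2 * a%:R.
      by rewrite ler_pM2l ?divr_gt0 // ler_nat; case/andP: na.
    lra.
rewrite mean_survS.
have : 0 <= mean k.+1 (fun t => (pruned t)%:R) :> R by rewrite mean_ge0.
suff : rho / 2 * n%:R * alpha * alpha <= polya k (fun a b c => (rho * k%:R + 3 * (3 * C + 1)) -
     (mean_surv1 a + mean_surv1 b + mean_surv1 c)).
  rewrite (polya_cstB _ _ (fun a b c => mean_surv1 a + mean_surv1 b + mean_surv1 c)); lra.
(* A child of size in [[11n, 22n)] is in the range of [def1]; this event costs the second factor
   [alpha]. *)
apply: (@polya_box_alpha _ (11 * n)); [lia|lia|..].
- by rewrite !mulr_ge0 // ?ltW // invr_gt0.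
- move=> a b c /(natr3 rho (3 * C + 1)) <-.
  have := surv1C a; have := surv1C b; have := surv1C c; lra.
- move=> a b c abc; move: (abc) => /(natr3 rho (3 * C + 1)) <- na _.
  have := surv1C b; have := surv1C c.
  case: a abc na => [|a] abc na; first lia.
  have := @def1 a; move=> /(_ ltac:(lia)); lra.
Qed.

Lemma ler_expr3 (r x y z : R) : 0 <= r -> r <= x -> r <= y -> r <= z ->
  r ^+ 3 <= x * y * z.
Proof.
move=> r0 rx ry rz; rewrite (_ : r ^+ 3 = r * r * r); last by ring.
exact: ler_pM (mulr_ge0 r0 r0) r0 (ler_pM r0 r0 rx ry) rz.
Qed.

(** A real-valued indicator, so that independence becomes the product rule [mean3_prod]. *)
Definition large (theta : R) (t : tree) : R := (theta <= (surv t)%:R)%R%:R.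
Definition large_children (theta : R) (t : tree) : R :=
  if t is Node a b c then large theta a * large theta b * large theta c else 0.

Lemma large_ge0 theta t : 0 <= large theta t. Proof. by []. Qed.
Lemma large_children_ge0 theta t : 0 <= large_children theta t.
Proof. by case: t => // a b c; rewrite !mulr_ge0. Qed.

Lemma large_children_minsurv theta t : 0 <= theta -> theta * large_children theta t <= (minsurv t)%:R.
Proof.
move=> th0; case: t => [|a b c]; first by rewrite mulr0.
rewrite /large_children /large minsurvN.
case: (leP theta (surv a)%:R) => ha; last by rewrite !mul0r mulr0.
case: (leP theta (surv b)%:R) => hb; last by rewrite mulr0 mul0r mulr0.
case: (leP theta (surv c)%:R) => hc; last by rewrite !mulr0.
by rewrite !mulr1 /minn; case: (surv b < surv c)%N; case: ifP.
Qed.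

(** A product of indicators is at most each factor, so the bound holds whichever child attains the
    minimum. *)
Lemma large_children_pruned theta a b c : 0 <= theta ->
  theta * (large_children theta a * large_children theta b * large_children theta c)
   <= (pruned (Node a b c))%:R.
Proof.
move=> th0.
have le1 t : large_children theta t <= 1.
  case: t => //= x y z; rewrite /large; do 3 case: (leP theta) => _; rewrite ?mulr0 ?mul0r ?mulr1 //.
have [a0 b0 c0] := And3 (large_children_ge0 theta a) (large_children_ge0 theta b) (large_children_ge0 theta c).
have [la lb lc] := And3 (large_children_minsurv a th0) (large_children_minsurv b th0) (large_children_minsurv c th0).
set p := _ * _ * _.
have pa : p <= large_children theta a.
  by rewrite /p -mulrA ler_piMr // mulr_ile1.
have pb : p <= large_children theta b.
  by rewrite /p mulrAC ler_piMl // mulr_ile1.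
have pc : p <= large_children theta c.
  by rewrite /p ler_piMl ?mulr_ge0 // mulr_ile1.
rewrite /pruned /minn; case: (minsurv b < minsurv c)%N; case: ifP => _;
  [apply: le_trans la|apply: le_trans lb|apply: le_trans la|apply: le_trans lc];
  by rewrite ler_wpM2l.
Qed.

(* If some size [j] in [n, 2n) is nearly extremal, then by monotonicity all nine
   grandchildren keep [theta] nodes with positive probability, and discarding
   one of them improves the bound. *)
Lemma surv_drop_extremal n k j : (0 < n)%N -> (55 * n <= k <= 110 * n)%N ->
  (n <= j < n + n)%N -> rho / 2 * j%:R <= mean_surv j ->
  mean_surv k.+1 <= rho * k%:R + 9 * C + 4 - rho / 4 * n%:R * (((rho / 4) ^+ 3 * alpha) ^+ 3 * alpha).
Proof.
move=> n0 /andP[nk kn] /andP[nj jn] high.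
have n2 : (0 < 2 * n)%N by lia.
have n11 : (0 < 11 * n)%N by lia.
(* The scales leave room for the third coordinate: [55n - 44n > 10n] for the children, and
   [10n - 8n >= 2n > j] for the grandchildren. *)
have box2 i : (10 * n < i.+1 <= 110 * n)%N -> ((2 * n).*2.*2 <= i <= 110 * (2 * n))%N by lia.
have box11 : ((11 * n).*2.*2 <= k <= 110 * (11 * n))%N by lia.
have size2 a b c : (10 * n < (a + b + c).+1)%N -> (2 * n <= a < 2 * n + 2 * n)%N ->
  (2 * n <= b < 2 * n + 2 * n)%N -> [/\ j <= a, j <= b & j <= c]%N by split; lia.
have size11 a b c : (a + b + c)%N = k -> (11 * n <= a < 11 * n + 11 * n)%N ->
    (11 * n <= b < 11 * n + 11 * n)%N ->
    [/\ 10 * n < a <= 110 * n, 10 * n < b <= 110 * n & 10 * n < c <= 110 * n]%N.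
  by split; lia.
have j0 : (0 < j)%N by lia.
 have a0 := alpha_gt0; have C0 := survC_ge0.
have nR : 0 < n%:R :> R by rewrite ltr0n.
have jR : 0 < j%:R :> R by rewrite ltr0n.
have r4 : 0 < rho / 4 by rewrite divr_gt0.
pose theta := rho / 4 * j%:R.
have th0 : 0 < theta by rewrite mulr_gt0.
(* Reverse Markov inequality: [surv] is at most [theta] plus [j] times the indicator, while its mean
   is at least [2 * theta]. *)
have largej : rho / 4 <= mean j (large theta).
  rewrite -(ler_pM2l jR).
  have : mean_surv j <= mean j (fun t => theta + j%:R * large theta t).
    apply: le_mean => t tj; rewrite /large; case: (leP theta (surv t)%:R) => [_|/ltW]; last by rewrite /= mulr0 addr0.
    have /andP[+ _] := surv_le_size t; rewrite tj -(ler_nat R) mulr1; lra.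
  rewrite meanD mean_cst meanZ /theta; lra.
have largei i : (j <= i)%N -> rho / 4 <= mean i (large theta).
  move=> ji; apply: le_trans largej _; apply: mean_grow => // t m.
  rewrite /large; case: (leP theta (surv t)%:R) => // le; rewrite (le_trans le) // ler_nat.
  by have [] := surv_grow t m.
have m0 i : 0 <= mean i (large theta) by exact/mean_ge0/large_ge0.
have mc0 i : 0 <= mean i (large_children theta) by exact/mean_ge0/large_children_ge0.
have r3 : 0 <= (rho / 4) ^+ 3 by rewrite exprn_ge0 // ltW.
have q0 : 0 <= (rho / 4) ^+ 3 * alpha by exact: mulr_ge0 r3 (ltW a0).
have childi i : (10 * n < i <= 110 * n)%N -> (rho / 4) ^+ 3 * alpha <= mean i (large_children theta).
  case: i => // i ni; rewrite mean_node.
  apply: (@polya_box_alpha _ (2 * n)); [exact: n2|exact: box2|exact: r3| |].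
  - move=> a b c _; rewrite mean3_prod; exact: mulr_ge0 (mulr_ge0 (m0 _) (m0 _)) (m0 _).
  - move=> a b c abc na nb; rewrite mean3_prod.
    have [|ja jb jc] := size2 a b c _ na nb; first by rewrite abc; case/andP: ni.
    exact: ler_expr3 (ltW r4) (largei a ja) (largei b jb) (largei c jc).
(* Nine large grandchildren give [(rho / 4) ^ 9]; the boxes at the root and in the three children
   give [alpha ^ 4]. *)
have pr : theta * (((rho / 4) ^+ 3 * alpha) ^+ 3 * alpha) <= mean k.+1 (fun t => (pruned t)%:R).
  rewrite mean_node; apply: (@le_trans _ _ (polya k (fun a b c => theta *
     (mean a (large_children theta) * mean b (large_children theta) * mean c (large_children theta))))).
    rewrite polyaZ ler_pM2l //.
    apply: (@polya_box_alpha _ (11 * n)); [exact: n11|exact: box11|exact: exprn_ge0| |].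
    - move=> a b c _; exact: mulr_ge0 (mulr_ge0 (mc0 _) (mc0 _)) (mc0 _).
    - move=> a b c abc na nb.
      have [ha hb hc] := size11 a b c abc na nb.
      exact: ler_expr3 q0 (childi a ha) (childi b hb) (childi c hc).
  apply: le_polya => a b c _; rewrite -mean3_prod.
  rewrite /mean3 -meanZ; apply: le_mean => x _; rewrite -meanZ; apply: le_mean => y _.
  rewrite -meanZ; apply: le_mean => z _; exact/large_children_pruned/ltW.
move: pr (mulr_ge0 (exprn_ge0 3 q0) (ltW a0)) => {childi q0 r3}.
move: (((rho / 4) ^+ 3 * alpha) ^+ 3 * alpha) => s pr s0.
have : rho / 4 * n%:R * s <= theta * s.
  by apply: ler_wpM2r => //; rewrite ler_pM2l // ler_nat.
rewrite mean_survS.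
suff : polya k (fun a b c => mean_surv1 a + mean_surv1 b + mean_surv1 c) <= rho * k%:R + 3 * (3 * C + 1).
  lra.
rewrite -[leRHS](polya_cst k); apply: le_polya => a b c /(natr3 rho (3 * C + 1)) <-.
by rewrite !lerD // surv1C.
Qed.

(** The tenth factor [rho / 4] comes from [theta], and [n >= k / 110] gives the denominator. The
    deficient case gains at least as much. *)
Lemma surv_improve : exists C', forall k,
  mean_surv k <= (rho - (rho / 4) ^+ 10 * alpha ^+ 4 / 110) * k%:R + C'.
Proof.
set q := (rho / 4) ^+ 10 * alpha ^+ 4.
have a0 := alpha_gt0; have a1 := alpha_le1; have C0 := survC_ge0.
have r4 : 0 < rho / 4 by rewrite divr_gt0.
have r41 : rho / 4 <= 1 by rewrite ler_pdivrMr // mul1r (le_trans rho_le1) // ler1n.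
have q0 : 0 < q by rewrite mulr_gt0 ?exprn_gt0.
have qr : q <= rho / 4.
  rewrite -[leRHS]mulr1 /q exprS -mulrA ler_pM2l // mulr_ile1 ?exprn_ge0 ?exprn_ile1 // ltW //.
have qa : q <= rho / 4 * alpha ^+ 2.
  rewrite /q exprS -mulrA ler_pM2l // (exprD _ 2 2) mulrA ler_piMl ?exprn_ge0 ?(ltW a0) //.
  by rewrite mulr_ile1 ?exprn_ge0 ?exprn_ile1 // ltW.
(* For [k < 55] the size bound is at most 55, which the constant 60 absorbs. *)
exists (9 * C + 60) => -[|k]; first by rewrite mulr0; have := mean_surv_le 0; lra.
have kk : k.+1%:R = k%:R + 1 :> R by rewrite -addn1 natrD.
case: (ltnP k 55) => [k55|k55].
  have := mean_surv_le k.+1.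
  have : k%:R <= 55 :> R by rewrite ler_nat ltnW.
  have : 0 <= (rho - q / 110) * k.+1%:R by rewrite mulr_ge0 //; lra.
  lra.
(* Since [n >= 1], the remainder is below [55n], whence [k <= 110n]. *)
pose n := (k %/ 55)%N.
have n0 : (0 < n)%N by rewrite divn_gt0.
have nk : (55 * n <= k <= 110 * n)%N.
  by have := divn_eq k 55; have := ltn_pmod k (isT : (0 < 55)%N); rewrite -/n; lia.
have nR : 0 < n%:R :> R by rewrite ltr0n.
have kn : k%:R <= 110 * n%:R :> R by rewrite -natrM ler_nat; case/andP: nk.
have main : mean_surv k.+1 <= rho * k%:R + 9 * C + 4 - q * n%:R.
  have [[j /andP[nj hj]]|low] := pselect (exists j, (n <= j < n + n)%N && (rho / 2 * j%:R <= mean_surv j)).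
    apply: le_trans (surv_drop_extremal n0 nk nj hj) _; rewrite /q.
    rewrite lerD2l lerN2 le_eqVlt; apply/orP; left; apply/eqP; ring.
  have {}low j : (n <= j < n + n)%N -> mean_surv j <= rho / 2 * j%:R.
    move=> nj; rewrite leNgt; apply/negP => lt; apply: low; exists j.
    by rewrite nj ltW.
  apply: le_trans (surv_drop_deficient n0 nk low) _.
  rewrite lerD2l lerN2 [leRHS]mulrAC ler_pM2r //.
  apply: (le_trans qa); rewrite ler_pM2r ?exprn_gt0 //; lra.
have : q / 110 * k%:R <= q * n%:R.
  by rewrite -mulrA ler_pM2l // ler_pdivrMl.
rewrite kk; lra.
Qed.
End Step.

(** The decrement of [surv_improve] increases with the slope, so as long as the slope exceeds [eps]
    each round lowers it by at least the decrement [q] at [eps]. *)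
Lemma mean_surv_little_o (eps : R) : 0 < eps -> exists C, forall k,
  mean_surv k <= eps * k%:R + C.
Proof.
move=> eps0.
wlog eps1 : eps eps0 / eps <= 1.
  move=> H; case: (leP eps 1) => [|/ltW] e1; first exact: H.
  exists 0 => k; rewrite addr0; apply: le_trans (mean_surv_le k) _.
  by rewrite ler_peMl.
pose q := (eps / 4) ^+ 10 * alpha ^+ 4 / 110.
have a0 := alpha_gt0.
have q0 : 0 < q by rewrite divr_gt0 // mulr_gt0 ?exprn_gt0 // divr_gt0.
have H i : exists C, forall k, mean_surv k <= Num.max eps (1 - i%:R * q) * k%:R + C.
  elim: i => [|i [C IH]].
    exists 0 => k; rewrite mul0r subr0 addr0 max_r // mul1r; exact: mean_surv_le.
  case: (leP (1 - i%:R * q) eps) => [le|lt].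
    exists C => k; apply: le_trans (IH k) _.
    rewrite max_l // lerD2r ler_wpM2r //.
    by rewrite le_max lexx.
  rewrite max_r in IH; last exact: ltW.
  have i0 : 0 <= i%:R * q by rewrite mulr_ge0 // ltW.
  have [||C' H'] := @surv_improve (1 - i%:R * q) C _ _ IH; [lra|lra|].
  exists C' => k; apply: le_trans (H' k) _; rewrite lerD2r ler_wpM2r //.
  rewrite le_max; apply/orP; right.
  have : q <= ((1 - i%:R * q) / 4) ^+ 10 * alpha ^+ 4 / 110.
    have e4 : 0 <= eps / 4 by rewrite divr_ge0 // ltW.
    have le4 : eps / 4 <= (1 - i%:R * q) / 4 by rewrite ler_pM2r ?invr_gt0 // ltW.
    rewrite {1}/q ler_pM2r ?invr_gt0 // ler_pM2r ?exprn_gt0 //.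
    by rewrite lerXn2r ?nnegrE // (le_trans e4).
  rewrite -[i.+1]addn1 natrD; lra.
(* More than [1 / q] rounds exhaust the initial slope 1. *)
have [C HC] := H (Num.bound q^-1).
exists C => k; have := HC k; rewrite max_l //.
have := archi_boundP (ltW (_ : 0 < q^-1)); rewrite invr_gt0 => /(_ q0) lt.
have : 1 <= (Num.bound q^-1)%:R * q by rewrite -ler_pdivrMr // div1r ltW.
lra.
Qed.
End MeanSurv.

Theorem theorem1 (R : realType) (eps : R) (eps_gt0 : 0 < eps) :
  ran_prob R [set h : ran_history k |
      (longest_path (ran_graph h))%:R <= eps * (k.*2.+1)%:R]%SET
    @[k --> \oo] --> (1 : R).
Proof.
apply/cvgrPdist_le => d d0.
(* There are [2k + 1] faces, so the slope [eps * d] uses about half of the allowed failure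
   probability [d]; the other half absorbs [C + 3]. *)
have [C HC] := mean_surv_little_o (mulr_gt0 eps_gt0 d0).
near=> k.
set A := [set h | _]%SET.
have card0 : 0 < #|ran_history k|%:R :> R by rewrite ltr0n card_history_gt0.
have k0 : 0 < eps * (k.*2.+1)%:R by rewrite mulr_gt0 // ltr0n.
have PA : ran_prob R A + ran_prob R (~: A)%SET = 1.
  rewrite /ran_prob -mulrDl -natrD cardsC divff // gt_eqF //.
have -> : 1 - ran_prob R A = ran_prob R (~: A)%SET by rewrite -PA addrC addKr.
have markov : eps * (k.*2.+1)%:R * ran_prob R (~: A)%SET <= mean_surv R k + 3.
  rewrite -(mean_cst k 3) -meanD /mean /ran_prob mulrA ler_pM2r ?invr_gt0 //.
  rewrite [leLHS]mulr_natr -sumr_const; apply: (@le_trans _ _ (\sum_(h in (~: A)%SET) ((surv (history_tree h))%:R + 3))).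
    apply: ler_sum => h; rewrite !inE -ltNge => /ltW /le_trans; apply.
    by rewrite -natrD ler_nat addn3 longest_path_surv.
  by rewrite [leRHS](bigID (mem (~: A)%SET)) /= lerDl sumr_ge0.
rewrite ger0_norm; last by rewrite divr_ge0.
rewrite -(ler_pM2l k0); apply: le_trans markov _.
have := HC k.
have -> : (k.*2.+1)%:R = k%:R *+ 2 + 1 :> R by rewrite -[k.*2.+1]addn1 -muln2 natrD natrM; ring.
have : C + 3 <= eps * d * k%:R.
  rewrite mulrC -ler_pdivrMr ?mulr_gt0 //; near: k; exact: nbhs_infty_ger.
have : 0 < eps * d by rewrite mulr_gt0.
lra.
Unshelve. all: by end_near.
Qed.
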